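(* For every $n\ge 3$ there is an example of an intermediate quantum group $O_n^+\supset G\supset S_n$ such that $G$ is not an easy quantum group. That is, there is a compact matrix quantum group $(C(G),u)$ of size $n$, with $*$-homomorphisms $C(O_n^+)\to C(G)\to C(S_n)$ mapping the entries of the fundamental corepresentations to each other, which is not easy.
   Context: A compact matrix quantum group (CMQG) of size $n$ is a pair $(A,u)$ of a unital $C^*$-algebra $A$ and a unitary $u=(u_{ij})\in M_n(A)$ such that the $u_{ij}$ generate $A$, there is a $*$-homomorphism $\Delta:A\to A\otimes A$ with $\Delta(u_{ij})=\sum_k u_{ik}\otimes u_{kj}$, and $u^t$ is invertible. It is orthogonal if $u_{ij}^*=u_{ij}$ for all $i,j$. $C(G)$ denotes a CMQG in its maximal version (the universal enveloping $C^*$-algebra of the $*$-algebra generated by the $u_{ij}$). $C(O_n^+)$ is the universal $C^*$-algebra generated by self-adjoint elements $u_{ij}$, $1\le i,j\le n$, such that $(u_{ij})$ is unitary. $C(S_n)$ is a CMQG with fundamental corepresentation $p_{ij}(\sigma)=1$ if $\sigma(j)=i$ and $0$ otherwise. Partitions: $P(k,l)$ is the set of set partitions (into blocks) of $k$ upper and $l$ lower points, each row ordered from left to right. Operations: tensor product (juxtaposition); composition $qp\in P(k,m)$ for $p\in P(k,l)$, $q\in P(l,m)$ (put $p$ above $q$, join along the $l$ middle points, delete the middle points and any blocks contained in them); involution (turn upside down); rotation (moving the leftmost, or rightmost, point of one row to the leftmost, resp. rightmost, position of the other row, keeping blocks). A category of partitions $\mathcal{C}$ is a collection of subsets $\mathcal{C}(k,l)\subset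 P(k,l)$, $k,l\ge0$, closed under these operations and containing the one-block pair partition on two points. For $p\in P(k,l)$, $T_p:(\mathbb{C}^n)^{\otimes k}\to(\mathbb{C}^n)^{\otimes l}$ is $T_p(e_{i_1}\otimes\cdots\otimes e_{i_k})=\sum_{j}\delta_p(i,j)\,e_{j_1}\otimes\cdots\otimes e_{j_l}$, where $\delta_p(i,j)=1$ if labelling the upper points by $i$ and the lower points by $j$ gives equal labels on each block of $p$, and $0$ otherwise. An orthogonal CMQG $(A,u)$ of size $n$ is easy if there is a category of partitions $\mathcal{C}$ such that for all $k,l$ the space $\{T: Tu^{\otimes k}=u^{\otimes l}T\}$ of intertwiners equals $\mathrm{span}\{T_p:p\in\mathcal{C}(k,l)\}$. *)

(* Defs.v *)
From HB Require Import structures.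
From mathcomp Require Import all_boot all_order all_algebra all_fingroup.
From mathcomp Require Import complex.
From mathcomp Require classical_sets.
From mathcomp Require Import boolp reals.
Import Order.TTheory GRing.Theory Num.Theory ComplexField.Normc.

Set Implicit Arguments.
Unset Strict Implicit.
Unset Printing Implicit Defensive.

Local Open Scope ring_scope.
Local Open Scope complex_scope.

(** * Unital C*-algebras *)

(* The norm is a separate real-valued field, and completeness is sequential:
   MathComp has no join of its normed modules with its rings.  Algebras are
   nontrivial, so [1 != 0]. *)
HB.mixin Record isCStar (R : realType) A of GRing.Algebra R[i] A := {
  star : A -> A;
  cnorm : A -> R;
  starD : forall x y, star (x + y) = star x + star y;
  starZ : forall (a : R[i]) x, star (a *: x) = a^* *: star x;
  starM : forall x y, star (x * y) = star y * star x;
  starK : forall x, star (star x) = x;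
  cnorm_eq0 : forall x, cnorm x = 0 -> x = 0;
  ler_cnormD : forall x y, cnorm (x + y) <= cnorm x + cnorm y;
  cnormZ : forall (a : R[i]) x, cnorm (a *: x) = normc a * cnorm x;
  ler_cnormM : forall x y, cnorm (x * y) <= cnorm x * cnorm y;
  cnorm_starM : forall x, cnorm (star x * x) = cnorm x ^+ 2;
  cnorm_complete : forall s : nat -> A,
    (forall e : R, 0 < e -> exists N, forall m p,
       (N <= m)%N -> (N <= p)%N -> cnorm (s m - s p) < e) ->
    exists l, forall e : R, 0 < e -> exists N, forall m,
       (N <= m)%N -> cnorm (s m - l) < e
}.

#[short(type="cstarAlgType")]
HB.structure Definition CStarAlgebra (R : realType) :=
  {A of GRing.Algebra R[i] A & isCStar R A}.

Section CStar.
Context {R : realType}.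
Implicit Types A B T : cstarAlgType R.

Definition star_subalgebra A (S : A -> Prop) : Prop :=
  [/\ S 1,
      forall (a : R[i]) x y, S x -> S y -> S (a *: x + y),
      forall x y, S x -> S y -> S (x * y)
    & forall x, S x -> S (star x)].

Definition star_morphism_on A B (S : A -> Prop) (f : A -> B) : Prop :=
  [/\ f 1 = 1,
      forall (a : R[i]) x y, S x -> S y -> f (a *: x + y) = a *: f x + f y,
      forall x y, S x -> S y -> f (x * y) = f x * f y
    & forall x, S x -> f (star x) = star (f x)].

Definition star_morphism A B (f : A -> B) : Prop :=
  star_morphism_on (fun _ => True) f.

(** ** The minimal tensor product *)

Definition lin_indep A m (a : 'I_m -> A) : Prop :=
  forall c : 'I_m -> R[i], \sum_i c i *: a i = 0 -> forall i, c i = 0.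

Definition tsum A B T (t : A -> B -> T) (s : seq (A * B)) : T :=
  \sum_(ab <- s) t ab.1 ab.2.

(* [T] is the completion of the algebraic tensor product of [A] and [B] for
   some C*-norm, [t a b] being the elementary tensor of [a] and [b].  The field
   [tensor_inj] says that the algebraic tensor product embeds in [T]. *)
Record cstar_tensor A B T (t : A -> B -> T) : Prop := {
  tensorPl : forall (c : R[i]) a a' b, t (c *: a + a') b = c *: t a b + t a' b;
  tensorPr : forall (c : R[i]) a b b', t a (c *: b + b') = c *: t a b + t a b';
  tensor1 : t 1 1 = 1;
  tensorM : forall a a' b b', t (a * a') (b * b') = t a b * t a' b';
  tensor_star : forall a b, t (star a) (star b) = star (t a b);
  tensor_inj : forall m (a : 'I_m -> A) (b : 'I_m -> B), lin_indep a ->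
    \sum_i t (a i) (b i) = 0 -> forall i, b i = 0;
  tensor_dense : forall x (e : R), 0 < e ->
    exists s : seq (A * B), cnorm (x - tsum t s) < e
}.

Definition min_tensor A B T (t : A -> B -> T) : Prop :=
  cstar_tensor t /\
  forall T' (t' : A -> B -> T'), cstar_tensor t' ->
    forall s, cnorm (tsum t s) <= cnorm (tsum t' s).

(** * Compact matrix quantum groups *)

Section Matrix.
Context {A : cstarAlgType R} {n : nat}.
Implicit Types u : 'M[A]_n.

Definition adjmx u : 'M[A]_n := \matrix_(i, j) star (u j i).

Definition unitary u : Prop := u *m adjmx u = 1%:M /\ adjmx u *m u = 1%:M.

Definition self_adjoint_entries u : Prop := forall i j, star (u i j) = u i j.

(* the unital *-subalgebra generated by the entries of [u] *)
Definition star_gen u (x : A) : Prop :=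
  forall S, star_subalgebra S -> (forall i j, S (u i j)) -> S x.

Definition generates u : Prop :=
  forall x (e : R), 0 < e -> exists2 y, star_gen u y & cnorm (x - y) < e.

Definition has_comultiplication u : Prop :=
  exists (T : cstarAlgType R) (t : A -> A -> T) (Delta : A -> T),
    [/\ min_tensor t, star_morphism Delta
      & forall i j, Delta (u i j) = \sum_k t (u i k) (u k j)].

Definition cmqg u : Prop :=
  [/\ generates u, unitary u, has_comultiplication u
    & exists v : 'M[A]_n, u^T *m v = 1%:M /\ v *m u^T = 1%:M].

Definition orthogonal_cmqg u : Prop := cmqg u /\ self_adjoint_entries u.

(* [A] has the universal property of the enveloping C*-algebra of the
   *-algebra generated by the entries of [u]; uniqueness of [g] follows when
   [u] generates [A]. *)
Definition maximal u : Prop :=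
  forall B (f : A -> B), star_morphism_on (star_gen u) f ->
    exists g : A -> B, star_morphism g /\ forall x, star_gen u x -> g x = f x.

End Matrix.

(* [(A, u)] is a model of C(O_n^+) *)
Definition free_orthogonal A n (u : 'M[A]_n) : Prop :=
  [/\ generates u, self_adjoint_entries u, unitary u
    & forall B (v : 'M[B]_n), self_adjoint_entries v -> unitary v ->
      exists f : A -> B, star_morphism f /\ forall i j, f (u i j) = v i j].

End CStar.

(** * Functions on a finite set, with base point [x0] ensuring nonemptiness *)

Definition Cfin (R : realType) (X : finType) (x0 : X) := {ffun X -> R[i]}.

Section CfinAlgebra.
Variables (R : realType) (X : finType) (x0 : X).
Local Notation CX := (Cfin R x0).
Implicit Types f g : CX.

HB.instance Definition _ := GRing.Lmodule.on CX.
HB.instance Definition _ := GRing.PzRing.on CX.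

Fact Cfin1_neq0 : (1 : CX) != 0.
Proof. exact: (ffun1_nonzero _ x0). Qed.
HB.instance Definition _ := GRing.PzSemiRing_isNonZero.Build CX Cfin1_neq0.

Fact Cfin_scaleAl (a : R[i]) f g : a *: (f * g) = (a *: f) * g.
Proof. by apply/ffunP => x; rewrite !ffunE scalerAl. Qed.
HB.instance Definition _ := GRing.Lmodule_isLalgebra.Build R[i] CX Cfin_scaleAl.

Fact Cfin_scaleAr (a : R[i]) f g : a *: (f * g) = f * (a *: g).
Proof. by apply/ffunP => x; rewrite !ffunE; exact: mulrCA. Qed.
HB.instance Definition _ := GRing.Lalgebra_isAlgebra.Build R[i] CX Cfin_scaleAr.

Definition Cfin_star f : CX := [ffun x => (f x)^*].
Definition Cfin_norm f : R := \big[Num.max/0]_x normc (f x).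

Lemma normc_ge0 (z : R[i]) : 0 <= normc z.
Proof. by case: z => a b; rewrite sqrtr_ge0. Qed.

Lemma normc_conj (z : R[i]) : normc z^* = normc z.
Proof. by case: z => a b; rewrite /normc /= sqrrN. Qed.

Lemma le_Cfin_norm f x : normc (f x) <= Cfin_norm f.
Proof. exact: le_bigmax. Qed.

Lemma Cfin_norm_le f c : (forall x, normc (f x) <= c) -> Cfin_norm f <= c.
Proof.
by move=> fc; apply: bigmax_le => //; exact: le_trans (normc_ge0 (f x0)) (fc x0).
Qed.

Lemma Cfin_norm_lt f c : (forall x, normc (f x) < c) -> Cfin_norm f < c.
Proof.
move=> fc; apply: bigmax_lt => //.
exact: le_lt_trans (normc_ge0 (f x0)) (fc x0).
Qed.

Lemma Cfin_norm_ge0 f : 0 <= Cfin_norm f.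
Proof. exact: le_trans (normc_ge0 _) (le_Cfin_norm f x0). Qed.

Lemma Cfin_norm_witness f : exists x, Cfin_norm f = normc (f x).
Proof.
have [x _ fx] := @eq_bigmax _ _ _ 0 x0 xpredT (fun x => normc (f x)) isT
  (fun x _ => normc_ge0 (f x)).
by exists x.
Qed.

Fact Cfin_starD f g : Cfin_star (f + g) = Cfin_star f + Cfin_star g.
Proof. by apply/ffunP => x; rewrite !ffunE rmorphD. Qed.

Fact Cfin_starZ (a : R[i]) f : Cfin_star (a *: f) = a^* *: Cfin_star f.
Proof. by apply/ffunP => x; rewrite !ffunE rmorphM. Qed.

Fact Cfin_starM f g : Cfin_star (f * g) = Cfin_star g * Cfin_star f.
Proof. by apply/ffunP => x; rewrite !ffunE rmorphM mulrC. Qed.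

Fact Cfin_starK f : Cfin_star (Cfin_star f) = f.
Proof. by apply/ffunP => x; rewrite !ffunE conjcK. Qed.

Fact Cfin_norm_eq0 f : Cfin_norm f = 0 -> f = 0.
Proof.
move=> f0; apply/ffunP => x; rewrite ffunE; apply: eq0_normc.
by apply/eqP; rewrite eq_le normc_ge0 andbT -f0 le_Cfin_norm.
Qed.

Fact Cfin_normD f g : Cfin_norm (f + g) <= Cfin_norm f + Cfin_norm g.
Proof.
apply: Cfin_norm_le => x; rewrite ffunE.
by apply: le_trans (le_normcD _ _) _; apply: lerD; exact: le_Cfin_norm.
Qed.

Fact Cfin_normZ (a : R[i]) f : Cfin_norm (a *: f) = normc a * Cfin_norm f.
Proof.
apply: le_anti; apply/andP; split.
  apply: Cfin_norm_le => x; rewrite ffunE normcM.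
  by rewrite ler_wpM2l ?normc_ge0 ?le_Cfin_norm.
have [x ->] := Cfin_norm_witness f.
by have := le_Cfin_norm (a *: f) x; rewrite ffunE normcM.
Qed.

Fact Cfin_normM f g : Cfin_norm (f * g) <= Cfin_norm f * Cfin_norm g.
Proof.
apply: Cfin_norm_le => x; rewrite ffunE normcM.
by apply: ler_pM; rewrite ?normc_ge0 ?le_Cfin_norm.
Qed.

Fact Cfin_norm_starM f : Cfin_norm (Cfin_star f * f) = Cfin_norm f ^+ 2.
Proof.
apply: le_anti; apply/andP; split.
  apply: Cfin_norm_le => x; rewrite !ffunE normcM normc_conj expr2.
  by apply: ler_pM; rewrite ?normc_ge0 ?le_Cfin_norm.
have [x ->] := Cfin_norm_witness f.
by have := le_Cfin_norm (Cfin_star f * f) x; rewrite !ffunE normcM normc_conj expr2.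
Qed.

Lemma cauchy_seq_real (s : nat -> R) :
  (forall e : R, 0 < e -> exists N, forall m p,
    (N <= m)%N -> (N <= p)%N -> `|s m - s p| < e) ->
  exists l, forall e : R, 0 < e -> exists N, forall m,
    (N <= m)%N -> `|s m - l| < e.
Proof.
move=> cs; pose E : classical_sets.set R := fun x => exists N, forall m, (N <= m)%N -> x <= s m.
have bnd (e : R) : 0 < e -> exists N, forall m, (N <= m)%N ->
    E (s m - e) /\ classical_sets.ubound E (s m + e).
  move=> /cs[N HN]; exists N => m Nm; split.
    exists N => p Np; have := HN m p Nm Np.
    by rewrite ltr_distlC => /andP[+ _]; rewrite ltrBlDr => /ltW; rewrite lerBlDr.
  move=> x [M HM]; apply: le_trans (HM (maxn M N) (leq_maxl _ _)) _.
  have := HN _ _ (leq_maxr M N) Nm.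
  by rewrite ltr_distl => /andP[_ /ltW].
have supE : classical_sets.has_sup E.
  have [N HN] := bnd 1 ltr01; have [EN uN] := HN N (leqnn _).
  by split; [exists (s N - 1) | exists (s N + 1)].
exists (sup E) => e e0; have e2 : 0 < e / 2 by rewrite divr_gt0.
have [N HN] := bnd _ e2; exists N => m /HN[Em um].
have h1 : s m - e / 2 <= sup E by apply: ub_le_sup => //; case: supE.
have h2 : sup E <= s m + e / 2 by apply: ge_sup => //; case: supE.
have e2e : e / 2 < e by rewrite ltr_pdivrMr // ltr_pMr // ltr1n.
rewrite distrC ltr_distl; apply/andP; split.
  by apply: lt_le_trans h1; rewrite ltrD2l ltrN2.
by apply: le_lt_trans h2 _; rewrite ltrD2l.
Qed.

Lemma norm_Re_le (z : R[i]) : `|complex.Re z| <= normc z.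
Proof.
case: z => a b /=; rewrite -sqrtr_sqr ler_wsqrtr //.
by rewrite lerDl sqr_ge0.
Qed.

Lemma norm_Im_le (z : R[i]) : `|complex.Im z| <= normc z.
Proof.
case: z => a b /=; rewrite -sqrtr_sqr ler_wsqrtr //.
by rewrite lerDr sqr_ge0.
Qed.

Lemma normc_le_ReIm (z : R[i]) :
  normc z <= `|complex.Re z| + `|complex.Im z|.
Proof.
case: z => a b /=; rewrite -[leRHS]ger0_norm ?addr_ge0 // -sqrtr_sqr.
rewrite ler_wsqrtr // sqrrD !real_normK ?num_real // lerD2r lerDl.
by rewrite mulrn_wge0 // mulr_ge0.
Qed.

Lemma cauchy_seq_complex (s : nat -> R[i]) :
  (forall e : R, 0 < e -> exists N, forall m p,
    (N <= m)%N -> (N <= p)%N -> normc (s m - s p) < e) ->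
  exists l, forall e : R, 0 < e -> exists N, forall m,
    (N <= m)%N -> normc (s m - l) < e.
Proof.
move=> cs.
have [|a Ha] := cauchy_seq_real (s := fun m => complex.Re (s m)).
  move=> e /cs[N HN]; exists N => m p Nm Np.
  by rewrite -raddfB; apply: le_lt_trans (norm_Re_le _) (HN _ _ Nm Np).
have [|b Hb] := cauchy_seq_real (s := fun m => complex.Im (s m)).
  move=> e /cs[N HN]; exists N => m p Nm Np.
  by rewrite -raddfB; apply: le_lt_trans (norm_Im_le _) (HN _ _ Nm Np).
exists (a +i* b) => e e0; have e2 : 0 < e / 2 by rewrite divr_gt0.
have [[N HN] [M HM]] := (Ha _ e2, Hb _ e2); exists (maxn N M) => m.
rewrite geq_max => /andP[/HN Nm /HM Mm].
apply: le_lt_trans (normc_le_ReIm _) _; rewrite [ltRHS]splitr.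
by move: Nm Mm; case: (s m) => c d /= Nm Mm; exact: ltrD.
Qed.

Fact Cfin_complete (s : nat -> CX) :
  (forall e : R, 0 < e -> exists N, forall m p,
    (N <= m)%N -> (N <= p)%N -> Cfin_norm (s m - s p) < e) ->
  exists l, forall e : R, 0 < e -> exists N, forall m,
    (N <= m)%N -> Cfin_norm (s m - l) < e.
Proof.
move=> cs.
have /choice[l Hl] x : exists l, forall e : R, 0 < e -> exists N, forall m,
    (N <= m)%N -> normc (s m x - l) < e.
  apply: (cauchy_seq_complex (s := fun m => s m x)) => e /cs[N HN].
  exists N => m p Nm Np; apply: le_lt_trans (HN _ _ Nm Np).
  by have := le_Cfin_norm (s m - s p) x; rewrite !ffunE.
exists [ffun x => l x] => e e0.
have /choice[N HN] x := Hl x e e0.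
exists (\max_x N x)%N => m Nm; apply: Cfin_norm_lt => x; rewrite !ffunE.
by apply: HN; apply: leq_trans Nm; exact: leq_bigmax.
Qed.

HB.instance Definition _ := isCStar.Build R CX
  Cfin_starD Cfin_starZ Cfin_starM Cfin_starK Cfin_norm_eq0 Cfin_normD
  Cfin_normZ Cfin_normM Cfin_norm_starM Cfin_complete.
End CfinAlgebra.

(** ** C(S_n) *)

Definition CSym (R : realType) n : cstarAlgType R := Cfin R (1%g : 'S_n).

Definition sym_coord (R : realType) n : 'M[CSym R n]_n :=
  \matrix_(i, j) [ffun s : 'S_n => (s j == i)%:R].

(** * Partitions *)

(* Upper points are [inl a], lower points [inr b].  An element of [blocks k l]
   belongs to P(k,l) when it satisfies [is_part]; the operations below are
   defined on all sets of blocks. *)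
Notation points k l := ('I_k + 'I_l)%type.
Notation blocks k l := {set {set points k l}}.

Definition is_part k l (p : blocks k l) : bool := partition p [set: points k l].

Section PartitionOperations.
Context {k l : nat}.

Definition relabel k' l' (f : points k l -> points k' l') (p : blocks k l) :
    blocks k' l' :=
  [set f @: (B : {set points k l}) | B in p].

Definition tens_l k' l' (x : points k l) : points (k + k') (l + l') :=
  match x with inl a => inl (lshift k' a) | inr b => inr (lshift l' b) end.

Definition tens_r k' l' (x : points k l) : points (k' + k) (l' + l) :=
  match x with inl a => inl (rshift k' a) | inr b => inr (rshift l' b) end.

Definition flip (x : points k l) : points l k :=
  match x with inl a => inr a | inr b => inl b end.

Definition part_invol (p : blocks k l) : blocks l k := relabel flip p.

End PartitionOperations.

Definition part_tensor k l k' l' (p : blocks k l) (q : blocks k' l') :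
    blocks (k + k') (l + l') :=
  relabel (tens_l k' l') p :|: relabel (tens_r k l) q.

Section Composition.
Context {k l m : nat}.
(* three rows: [inl (inl _)] upper, [inl (inr _)] middle, [inr _] lower *)
Local Notation rows := (('I_k + 'I_l) + 'I_m)%type.

Definition upper_rows (x : points k l) : rows := inl x.

Definition lower_rows (x : points l m) : rows :=
  match x with inl b => inl (inr b) | inr c => inr c end.

Definition outer_rows (x : points k m) : rows :=
  match x with inl a => inl (inl a) | inr c => inr c end.

Definition linked (q : blocks l m) (p : blocks k l) : rel rows := fun x y =>
  [exists B in p, (x \in upper_rows @: (B : {set points k l}))
                  && (y \in upper_rows @: (B : {set points k l}))]
  || [exists B in q, (x \in lower_rows @: (B : {set points l m}))
                     && (y \in lower_rows @: (B : {set points l m}))].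

(* the composition [q p], with [p] above [q] *)
Definition part_comp (q : blocks l m) (p : blocks k l) : blocks k m :=
  equivalence_partition
    (fun x y => connect (linked q p) (outer_rows x) (outer_rows y)) setT.

End Composition.

Section Rotation.
Context {k l : nat}.

(* the upper point at position [a] becomes the lower point at position [b] *)
Definition move_down (a : 'I_k.+1) (b : 'I_l.+1) (x : points k.+1 l) :
    points k l.+1 :=
  match x with
  | inl c => if unlift a c is Some c' then inl c' else inr b
  | inr d => inr (lift b d)
  end.

(* the lower point at position [b] becomes the upper point at position [a] *)
Definition move_up (a : 'I_k.+1) (b : 'I_l.+1) (x : points k l.+1) :
    points k.+1 l :=
  match x with
  | inl c => inl (lift a c)
  | inr d => if unlift b d is Some d' then inr d' else inl a
  end.

Definition rot_left_down (p : blocks k.+1 l) : blocks k l.+1 :=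
  relabel (move_down ord0 ord0) p.
Definition rot_right_down (p : blocks k.+1 l) : blocks k l.+1 :=
  relabel (move_down ord_max ord_max) p.
Definition rot_left_up (p : blocks k l.+1) : blocks k.+1 l :=
  relabel (move_up ord0 ord0) p.
Definition rot_right_up (p : blocks k l.+1) : blocks k.+1 l :=
  relabel (move_up ord_max ord_max) p.

End Rotation.

Definition pair_part : blocks 0 2 := [set [set: points 0 2]].

Record category_of_partitions (C : forall k l, {set blocks k l}) : Prop := {
  cat_part : forall k l p, p \in C k l -> is_part p;
  cat_pair : pair_part \in C 0 2;
  cat_tensor : forall k l k' l' p q, p \in C k l -> q \in C k' l' ->
    part_tensor p q \in C (k + k')%N (l + l')%N;
  cat_comp : forall k l m p q, p \in C k l -> q \in C l m ->
    part_comp q p \in C k m;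
  cat_invol : forall k l p, p \in C k l -> part_invol p \in C l k;
  cat_rot_left_down : forall k l p, p \in C k.+1 l -> rot_left_down p \in C k l.+1;
  cat_rot_right_down : forall k l p,
    p \in C k.+1 l -> rot_right_down p \in C k l.+1;
  cat_rot_left_up : forall k l p, p \in C k l.+1 -> rot_left_up p \in C k.+1 l;
  cat_rot_right_up : forall k l p, p \in C k l.+1 -> rot_right_up p \in C k.+1 l
}.

(** * Intertwiners and easiness *)

Section Easy.
Context {R : realType}.

(* (C^n)^{\otimes k}, in coordinates for the basis [tbasis i] *)
Definition tspace n k : vectType R[i] := {ffun k.-tuple 'I_n -> R[i]^o}.

Definition tbasis n k (i : k.-tuple 'I_n) : tspace n k := [ffun j => (j == i)%:R].

Definition label n k l (i : k.-tuple 'I_n) (j : l.-tuple 'I_n) (x : points k l) :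
    'I_n :=
  match x with inl a => tnth i a | inr b => tnth j b end.

Definition delta_part n k l (p : blocks k l) (i : k.-tuple 'I_n)
    (j : l.-tuple 'I_n) : bool :=
  [forall B in p, forall x in B, forall y in B, label i j x == label i j y].

Definition Tfun n k l (p : blocks k l) (v : tspace n k) : tspace n l :=
  [ffun j => \sum_i v i * (delta_part p i j)%:R].

Definition Tpart n k l (p : blocks k l) : 'Hom(tspace n k, tspace n l) :=
  linfun (Tfun p).

Fact Tfun_linear n k l (p : blocks k l) : linear (@Tfun n k l p).
Proof.
move=> a v w; apply/ffunP => j; rewrite !ffunE scaler_sumr -big_split /=.
by apply: eq_bigr => i _; rewrite !ffunE mulrDl scalerAl.
Qed.

HB.instance Definition _ n k l (p : blocks k l) :=
  GRing.isLinear.Build R[i] (tspace n k) (tspace n l) _ (@Tfun n k l p)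
    (@Tfun_linear n k l p).

Lemma Tpart_basis n k l (p : blocks k l) (i : k.-tuple 'I_n) :
  Tpart n p (tbasis i) = \sum_(j | delta_part p i j) tbasis j.
Proof.
rewrite lfunE; apply/ffunP => j; rewrite !ffunE sum_ffunE.
rewrite (bigD1 i) //= big1 ?addr0 => [|i' /negPf i'i]; last first.
  by rewrite ffunE i'i mul0r.
rewrite ffunE eqxx mul1r big_mkcond (bigD1 j) //= big1 ?addr0.
  by rewrite ffunE eqxx; case: ifP.
by move=> j' j'j; case: ifP => // _; rewrite ffunE eq_sym (negPf j'j).
Qed.

Section Intertwiner.
Context {A : cstarAlgType R} {n : nat}.
Implicit Types u : 'M[A]_n.

Definition tens_power u k (i j : k.-tuple 'I_n) : A :=
  \prod_(m < k) u (tnth i m) (tnth j m).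

(* [T u^{\otimes k} = u^{\otimes l} T], as an equality of matrices over [A] *)
Definition intertwiner u k l (T : 'Hom(tspace n k, tspace n l)) : Prop :=
  forall (i : k.-tuple 'I_n) (j : l.-tuple 'I_n),
    \sum_r (T (tbasis r) j : R[i]) *: tens_power u r i
    = \sum_s (T (tbasis i) s : R[i]) *: tens_power u j s.

Definition easy u : Prop :=
  orthogonal_cmqg u /\
  exists C : forall k l, {set blocks k l},
    category_of_partitions C /\
    forall k l (T : 'Hom(tspace n k, tspace n l)),
      intertwiner u T <-> T \in <<[seq Tpart n p | p in C k l]>>%VS.

End Intertwiner.
End Easy.

(* Main.v *)
(** Let [J] be the all-ones matrix and [r = 1 - (2/n) J] the reflection along
    the vector [xi = sum_i e_i].  It commutes with the permutation matrices, so
    [G = S_n x {1, r}] is a finite group of real orthogonal matrices containing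
    [S_n], and [C(G)] is an orthogonal CMQG.  As [r xi = - xi], a vector fixed
    by [r^{(x)3}] is orthogonal to [xi^{(x)3}], whereas every [T_p], with [p] in
    [P(0,3)], has a positive pairing with [xi^{(x)3}]: if [G] were easy, its
    category would have no partition of three points and hence [u^{(x)3}] no
    nonzero fixed vector.  But [sum_i (Q e_i)^{(x)3}], where [Q = 1 - J/n] is
    the projection orthogonal to [xi], is fixed by [G], and is nonzero for
    [n >= 3]. *)
From HB Require Import structures.
Require Import Defs.
From mathcomp Require Import all_boot all_order all_algebra all_fingroup.
From mathcomp Require Import complex ring.
From mathcomp Require Import boolp reals.

Set Implicit Arguments.
Unset Strict Implicit.
Unset Printing Implicit Defensive.

Import Order.TTheory GRing.Theory Num.Theory ComplexField.Normc.
Local Open Scope ring_scope.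
Local Open Scope complex_scope.

(** * Positivity of the C*-norm *)

Section CStarNorm.
Variables (R : realType) (A : cstarAlgType R).
Implicit Type x : A.

Lemma cnorm0 : cnorm (0 : A) = 0.
Proof. by rewrite -(scale0r (0 : A)) cnormZ normc0 mul0r. Qed.

(** From [0 = cnorm (x - x) <= 2 cnorm x]. *)
Lemma cnorm_ge0 x : 0 <= cnorm x.
Proof.
have := ler_cnormD x (- x).
rewrite subrr cnorm0 -scaleN1r cnormZ normcN normc1 mul1r.
by rewrite -mulr2n pmulrn_lge0.
Qed.

Lemma cnorm_gt0 x : x != 0 -> 0 < cnorm x.
Proof.
move=> x0; rewrite lt_neqAle cnorm_ge0 andbT eq_sym.
by apply: contra_neq x0 => /cnorm_eq0.
Qed.

End CStarNorm.

(** * Function algebras of finite sets and their star subalgebras *)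

Section FiniteSpace.
Variables (R : realType) (X : finType) (x0 : X).
Local Notation CX := (Cfin R x0).

Lemma Cfin_prodE (I : Type) (s : seq I) (P : pred I) (F : I -> CX) x :
  (\prod_(i <- s | P i) F i) x = \prod_(i <- s | P i) F i x.
Proof. by apply: (big_morph (fun f : CX => f x)) => [f g|]; rewrite ffunE. Qed.

Lemma Cfin_sumE (I : Type) (s : seq I) (P : pred I) (F : I -> CX) x :
  (\sum_(i <- s | P i) F i) x = \sum_(i <- s | P i) F i x.
Proof. by apply: (big_morph (fun f : CX => f x)) => [f g|]; rewrite ffunE. Qed.

Lemma Cfin_addE (f g : CX) x : (f + g) x = f x + g x.
Proof. by rewrite ffunE. Qed.

Lemma Cfin_mulE (f g : CX) x : (f * g) x = f x * g x.
Proof. by rewrite ffunE. Qed.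

Lemma Cfin_scaleE (a : R[i]) (f : CX) x : (a *: f) x = a * f x.
Proof. by rewrite ffunE. Qed.

Lemma Cfin1E x : (1 : CX) x = 1.
Proof. by rewrite ffunE. Qed.

Lemma Cfin_oppE (f : CX) x : (- f) x = - f x.
Proof. by rewrite ffunE. Qed.

Definition Cfin_delta (x : X) : CX := [ffun y => (y == x)%:R].

Lemma Cfin_deltaE x y : Cfin_delta x y = (y == x)%:R.
Proof. by rewrite ffunE. Qed.

Lemma Cfin_sum_delta (f : CX) : f = \sum_x f x *: Cfin_delta x.
Proof.
apply/ffunP => y.
rewrite Cfin_sumE (bigD1 y isT) [X in _ = X + _]Cfin_scaleE Cfin_deltaE eqxx.
rewrite mulr1 big1 ?addr0 // => x /= /negPf xy.
by rewrite Cfin_scaleE Cfin_deltaE eq_sym xy mulr0.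
Qed.

(** Stone-Weierstrass for a finite set, by Lagrange interpolation: [Cfin_delta x] is a product over
    [y != x] of affine functions of separating elements, each factor being 1 at [x] and 0 at [y]. *)
Lemma star_subalgebra_separating (S : CX -> Prop) : star_subalgebra S ->
  (forall x y, x != y -> exists2 f, S f & f x != f y) -> forall f, S f.
Proof.
case=> S1 SD SM _ Ssep.
have S0 : S 0 by rewrite -(addNr 1) -scaleN1r; exact: SD.
have SZ a f : S f -> S (a *: f) by move=> Sf; rewrite -[_ *: _]addr0; exact: SD.
have Sdelta x : S (Cfin_delta x).
  have /choice[F HF] y : exists f, S f /\ (y != x -> f x != f y).
    (* The value of [F] at [x] is a placeholder: the product below leaves out [y = x]. *)
    have [->|yx] := eqVneq y x; first by exists 1.
    by rewrite eq_sym in yx; have [f Sf fxy] := Ssep _ _ yx; exists f.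
  have -> : Cfin_delta x = \prod_(y | y != x)
      ((F y x - F y y)^-1 *: (- F y y *: 1 + F y)).
    have factorE y z : ((F y x - F y y)^-1 *: (- F y y *: 1 + F y)) z
        = (F y x - F y y)^-1 * (F y z - F y y).
      rewrite Cfin_scaleE Cfin_addE Cfin_scaleE Cfin1E mulr1.
      by rewrite [X in _ * X]addrC.
    apply/ffunP => z; rewrite Cfin_prodE Cfin_deltaE.
    rewrite (eq_bigr _ (fun y _ => factorE y z)).
    have [->|zx] := eqVneq z x; last first.
      by rewrite (bigD1 z zx) subrr /= mulr0 mul0r.
    by rewrite big1 // => y /(proj2 (HF y)) Fy; rewrite mulVf ?subr_eq0.
  apply: (big_ind S) => // y _; apply/SZ/SD => //; exact: (HF y).1.
move=> f; rewrite (Cfin_sum_delta f); apply: (big_ind S) => // [g h Sg Sh|x _].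
  by rewrite -(scale1r g); exact: SD.
exact: SZ.
Qed.

End FiniteSpace.

Definition CfinE := (Cfin_addE, Cfin_oppE, Cfin_mulE, Cfin_scaleE, Cfin1E,
  Cfin_deltaE).

(** * The minimal tensor product of two finite function algebras *)

Section FiniteTensor.
Variables (R : realType) (X Y : finType) (x0 : X) (y0 : Y).

Definition Cfin_tensor (f : Cfin R x0) (g : Cfin R y0) : Cfin R (x0, y0) :=
  [ffun z => f z.1 * g z.2].

Lemma Cfin_tensorE f g z : Cfin_tensor f g z = f z.1 * g z.2.
Proof. by rewrite ffunE. Qed.

(** Injectivity: freezing the second variable at [y] turns the relation into a linear relation
    between the [a i] with coefficients [b i y]. Density is exact, since [f] is a finite sum of
    tensors of delta functions. *)
Lemma Cfin_tensorP : cstar_tensor Cfin_tensor.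
Proof.
split=> [c a a' b|c a b b'||a a' b b'|a b|m a b aP ab0 i|f e e0].
- by apply/ffunP => z; rewrite !(CfinE, Cfin_tensorE) mulrDl mulrA.
- by apply/ffunP => z; rewrite !(CfinE, Cfin_tensorE) mulrDr mulrCA.
- by apply/ffunP => z; rewrite !(CfinE, Cfin_tensorE) mulr1.
- by apply/ffunP => z; rewrite !(CfinE, Cfin_tensorE) mulrACA.
- by apply/ffunP => z; rewrite !ffunE rmorphM.
- apply/ffunP => y; rewrite [RHS]ffunE; apply: (aP (fun i => b i y)).
  apply/ffunP => x; rewrite Cfin_sumE ffunE.
  have := congr1 (fun f : Cfin R (x0, y0) => f (x, y)) ab0.
  rewrite Cfin_sumE ffunE => {2}<-.
  by apply: eq_bigr => j _; rewrite !ffunE [_ *: _]mulrC.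
- exists [seq (f z *: Cfin_delta R x0 z.1, Cfin_delta R y0 z.2)
            | z <- enum {: X * Y}].
  rewrite /tsum big_map big_enum /= [X in X - _](Cfin_sum_delta f).
  rewrite -sumrB big1 ?cnorm0 // => -[x y] _; apply/ffunP => -[x' y'].
  rewrite Cfin_addE Cfin_oppE Cfin_tensorE !Cfin_scaleE !Cfin_deltaE.
  by rewrite xpair_eqE -mulnb natrM mulrA [LHS]subrr ffunE.
Qed.

Lemma Cfin_min_tensor : min_tensor Cfin_tensor.
Proof.
split=> [|T t tP s]; first exact: Cfin_tensorP.
have t0l b : t 0 b = 0.
  by have := tensorPl tP (-1) 0 0 b; rewrite scaler0 addr0 scaleN1r addNr.
apply: Cfin_norm_le => -[x y].
set c := (tsum Cfin_tensor s : Cfin R (x0, y0)) (x, y).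
(* the minimal projection [e] compresses [tsum t s] to its value at (x, y) *)
pose e := t (Cfin_delta R x0 x) (Cfin_delta R y0 y).
(* This is [tensor_inj] for a family of one element; it lets [cnorm e] be cancelled at the end. *)
have e_neq0 : e != 0.
  apply/eqP => te0.
  have dP : lin_indep (fun _ : 'I_1 => Cfin_delta R x0 x).
    move=> a; rewrite big_ord1 => /ffunP/(_ x); rewrite !ffunE eqxx => a0 i.
    by rewrite (ord1 i) -[LHS]mulr1.
  have := tensor_inj tP (b := fun _ => Cfin_delta R y0 y) dP.
  rewrite big_ord1 => /(_ te0 ord0) /ffunP/(_ y); rewrite !ffunE eqxx.
  by apply/eqP; rewrite oner_eq0.
have dM (Z : finType) (z0 z : Z) (f : Cfin R z0) :
    Cfin_delta R z0 z * f = f z *: Cfin_delta R z0 z.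
  apply/ffunP => w; rewrite !ffunE; case: eqVneq => [->|_].
    by rewrite mul1r [RHS]mulr1.
  by rewrite mul0r scaler0.
have tZl a f g : t (a *: f) g = a *: t f g.
  by have := tensorPl tP a f 0 g; rewrite t0l !addr0.
have t0r f : t f 0 = 0.
  by have := tensorPr tP (-1) f 0 0; rewrite scaler0 addr0 scaleN1r addNr.
have tZr a f g : t f (a *: g) = a *: t f g.
  by have := tensorPr tP a f g 0; rewrite t0r !addr0.
have eE : e * tsum t s = c *: e.
  rewrite /c /tsum Cfin_sumE mulr_sumr scaler_suml; apply: eq_bigr => -[f g] _.
  by rewrite /e -tensorM // !dM tZl tZr scalerA ffunE.
have := ler_cnormM e (tsum t s).
by rewrite eE cnormZ mulrC ler_pM2l // cnorm_gt0.
Qed.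

End FiniteTensor.

(** * The quantum group of a finite group of real orthogonal matrices *)

Section MatrixMonoid.
Variables (R : realType) (X : finType) (x0 : X) (n : nat).
Variable rho : X -> 'M[R[i]]_n.

Definition coord_mx : 'M[Cfin R x0]_n := \matrix_(i, j) [ffun x => rho x i j].

Hypothesis rho_real : forall x i j, (rho x i j)^* = rho x i j.
Hypothesis rho_orth : forall x, rho x *m (rho x)^T = 1%:M.
Hypothesis rho_inj : injective rho.
Variable mul : X -> X -> X.
Hypothesis rhoM : forall x y, rho (mul x y) = rho x *m rho y.

Lemma coord_mx_self_adjoint : self_adjoint_entries coord_mx.
Proof. by move=> i j; apply/ffunP => x; rewrite !mxE !ffunE rho_real. Qed.

Lemma coord_mx_adj : adjmx coord_mx = coord_mx^T.
Proof.
by apply/matrixP => i j; rewrite [LHS]mxE coord_mx_self_adjoint [RHS]mxE.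
Qed.

Lemma coord_mx_orth :
  coord_mx *m coord_mx^T = 1%:M /\ coord_mx^T *m coord_mx = 1%:M.
Proof.
have oneE (i j : 'I_n) x : ((i == j)%:R : Cfin R x0) x = (i == j)%:R.
  by case: eqP => _; rewrite ffunE.
split; apply/matrixP => i j; rewrite !mxE; apply/ffunP => x.
  rewrite Cfin_sumE oneE.
  have /matrixP/(_ i j) := rho_orth x; rewrite !mxE => <-.
  by apply: eq_bigr => k _; rewrite !mxE !ffunE.
rewrite Cfin_sumE oneE.
have /matrixP/(_ i j) := mulmx1C (rho_orth x); rewrite !mxE => <-.
by apply: eq_bigr => k _; rewrite !mxE !ffunE.
Qed.

(** As [rho] is injective, the matrix entries separate points. *)
Lemma coord_mx_star_gen f : star_gen coord_mx f.
Proof.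
move=> S /star_subalgebra_separating SP Su; apply: SP => x y xy.
have /eqP : rho x != rho y by rewrite (inj_eq rho_inj).
move=> rxy; apply: contrapT => nS; apply: rxy; apply/matrixP => i j.
apply: contrapT => /eqP rij; apply: nS; exists (coord_mx i j) => //.
by rewrite !mxE !ffunE.
Qed.

Lemma coord_mx_unitary : unitary coord_mx.
Proof. by rewrite /unitary coord_mx_adj; exact: coord_mx_orth. Qed.

Lemma coord_mx_cmqg : cmqg coord_mx.
Proof.
have [uuT uTu] := coord_mx_orth.
split; last by exists coord_mx; exact: conj uTu uuT.
- by move=> f e e0; exists f; [exact: coord_mx_star_gen | rewrite subrr cnorm0].
- exact: coord_mx_unitary.
exists (Cfin R (x0, x0)), (@Cfin_tensor R X X x0 x0).
(* The comultiplication is dual to the product of matrices. *)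
exists (fun f : Cfin R x0 => [ffun z => f (mul z.1 z.2)] : Cfin R (x0, x0)).
split; first exact: Cfin_min_tensor.
  by split=> [|a f g _ _|f g _ _|f _]; apply/ffunP => z; rewrite !ffunE.
move=> i j; apply/ffunP => z; rewrite Cfin_sumE mxE !ffunE rhoM mxE.
by apply: eq_bigr => k _; rewrite !mxE !ffunE.
Qed.

(** The entries generate the whole algebra without completion, so [f] is its own extension. *)
Lemma coord_mx_maximal : maximal coord_mx.
Proof.
move=> B f [f1 fD fM fS]; exists f; split=> //.
by split=> // [a x y _ _|x y _ _|x _];
  [apply: fD | apply: fM | apply: fS]; exact: coord_mx_star_gen.
Qed.

(** Evaluating the intertwiner relation at each point [x] says that the vector [T 1] is fixed by
    every [rho x] acting on the [l]-th tensor power. *)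
Lemma intertwiner_vectorP l (T : 'Hom(tspace n 0, tspace n l)) :
  intertwiner coord_mx T <->
  forall x (j : l.-tuple 'I_n), T (tbasis [tuple]) j
    = \sum_s T (tbasis [tuple]) s * \prod_(m < l) rho x (tnth j m) (tnth s m).
Proof.
have tens0 (r i : 0.-tuple 'I_n) : tens_power coord_mx r i = 1.
  by rewrite /tens_power big_ord0.
have tensE (j s : l.-tuple 'I_n) x : tens_power coord_mx j s x
    = \prod_(m < l) rho x (tnth j m) (tnth s m).
  by rewrite Cfin_prodE; apply: eq_bigr => m _; rewrite mxE ffunE.
have lhsE (i : 0.-tuple 'I_n) j x :
    (\sum_r (T (tbasis r) j : R[i]) *: tens_power coord_mx r i) x
    = T (tbasis [tuple]) j.
  rewrite Cfin_sumE (bigD1 [tuple]) //= big1 ?addr0 => [|r].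
    by rewrite Cfin_scaleE tens0 Cfin1E mulr1.
  by case/eqP; exact: tuple0.
have rhsE j x :
    (\sum_s (T (tbasis [tuple]) s : R[i]) *: tens_power coord_mx j s) x
    = \sum_s T (tbasis [tuple]) s * \prod_(m < l) rho x (tnth j m) (tnth s m).
  by rewrite Cfin_sumE; apply: eq_bigr => s _; rewrite Cfin_scaleE tensE.
split=> [Tu x j|Tx i j]; first by rewrite -rhsE -Tu lhsE.
by apply/ffunP => x; rewrite lhsE (tuple0 i) rhsE.
Qed.

End MatrixMonoid.

(** * Coordinates of tensors, and vectors as maps out of the zeroth tensor power *)

Lemma sum_tuple_prod (C : comPzSemiRingType) (T : finType) k
    (F : 'I_k -> T -> C) :
  \sum_(s : k.-tuple T) \prod_m F m (tnth s m) = \prod_m \sum_t F m t.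
Proof.
rewrite bigA_distr_bigA.
rewrite (reindex (fun f : {ffun 'I_k -> T} => [tuple f m | m < k])) /=.
  by apply: eq_bigr => f _; apply: eq_bigr => m _; rewrite tnth_mktuple.
exists (fun s => [ffun m => tnth s m]) => [f _|s _].
  by apply/ffunP => m; rewrite ffunE tnth_mktuple.
by apply: eq_from_tnth => m; rewrite tnth_mktuple ffunE.
Qed.

Lemma tbasis_diag (R : realType) n k (i : k.-tuple 'I_n) :
  (tbasis i : tspace n k) i = 1 :> R[i].
Proof. by rewrite ffunE eqxx. Qed.

Section VectorHom.
Variables (R : realType) (n l : nat) (w : tspace (R := R) n l).

Definition vector_fun (v : tspace (R := R) n 0) : tspace (R := R) n l :=
  (v [tuple] : R[i]) *: w.

Fact vector_fun_linear : linear vector_fun.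
Proof. by move=> a v v'; rewrite /vector_fun !ffunE scalerDl scalerA. Qed.
HB.instance Definition _ :=
  GRing.isLinear.Build R[i] _ _ _ vector_fun vector_fun_linear.

Lemma vector_hom_tbasis : linfun vector_fun (tbasis [tuple]) = w.
Proof. by rewrite lfunE /= /vector_fun tbasis_diag scale1r. Qed.

End VectorHom.

(** * The group generated by the permutation matrices and the reflection *)

Section SymmetricWithReflection.
Variables (R : realType) (n : nat).
Local Notation C := R[i].

(* [(s, b)] stands for [P_s r^b], which is [P_s - (2 b / n) J] since
   [P_s J = J] *)
Definition refl_elt : finType := ('S_n * bool)%type.
Implicit Types x y : refl_elt.

Definition refl_coef (b : bool) : C := if b then 2%:R / n%:R else 0.

Definition refl_mx x : 'M[C]_n :=
  \matrix_(i, j) ((x.1 j == i)%:R - refl_coef x.2).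

Definition refl_one : refl_elt := (1%g, false).

(* [p * q] in ['S_n] is [q \o p] *)
Definition refl_mul x y : refl_elt := ((y.1 * x.1)%g, x.2 (+) y.2).

Lemma sum_perm_eq (s : 'S_n) i : \sum_j ((s j == i)%:R : C) = 1.
Proof.
rewrite (bigD1 ((s^-1)%g i)) //= permKV eqxx big1 ?addr0 // => j.
by rewrite -(inj_eq (@perm_inj _ s)) permKV => /negPf ->.
Qed.

Lemma sum_eq_perm (s : 'S_n) i : \sum_j ((s i == j)%:R : C) = 1.
Proof.
rewrite (bigD1 (s i)) //= eqxx big1 ?addr0 // => j.
by rewrite eq_sym => /negPf ->.
Qed.

Lemma sum_refl_mx_col x j :
  \sum_i refl_mx x i j = 1 - n%:R * refl_coef x.2.
Proof.
under eq_bigr do rewrite mxE.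
by rewrite sumrB sum_eq_perm sumr_const card_ord mulr_natl.
Qed.

Lemma refl_coef_conj b : (refl_coef b)^* = refl_coef b.
Proof. by case: b; rewrite /refl_coef ?rmorph0 // fmorph_div !rmorph_nat. Qed.

Lemma refl_mx_conj x i j : (refl_mx x i j)^* = refl_mx x i j.
Proof. by rewrite !mxE rmorphB rmorph_nat /= refl_coef_conj. Qed.

Hypothesis n_gt2 : (2 < n)%N.

Let n_neq0 : (n%:R : C) != 0.
Proof. by rewrite pnatr_eq0 -lt0n; apply: ltn_trans n_gt2. Qed.

Let i0 : 'I_n := Ordinal (ltn_trans (ltn0Sn 1) n_gt2).

(** Since [J^2 = n J], this is the coefficient of [- J] in [(1 - a J) (1 - b J)], with [a] and [b]
    standing for their coefficients. *)
Lemma refl_coefM a b : refl_coef a + refl_coef b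
  - n%:R * (refl_coef a * refl_coef b) = refl_coef (a (+) b).
Proof. by case: a b => -[]; rewrite /refl_coef /=; field. Qed.

Lemma refl_mxM x y : refl_mx (refl_mul x y) = refl_mx x *m refl_mx y.
Proof.
apply/matrixP => i j; rewrite !mxE permM /=.
have -> : \sum_k refl_mx x i k * refl_mx y k j
  = \sum_k ((x.1 k == i)%:R * (y.1 j == k)%:R : C)
    - \sum_k (x.1 k == i)%:R * refl_coef y.2
    - \sum_k (y.1 j == k)%:R * refl_coef x.2
    + \sum_(k < n) refl_coef x.2 * refl_coef y.2.
  by rewrite -!sumrB -big_split /=; apply: eq_bigr => k _; rewrite !mxE; ring.
rewrite -!mulr_suml sum_perm_eq sum_eq_perm sumr_const card_ord !mul1r.
rewrite -refl_coefM (bigD1 (y.1 j)) //= eqxx mulr1 big1 => [|k]; first by ring.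
by rewrite eq_sym => /negPf ->; rewrite mulr0.
Qed.

Lemma refl_mx_tr x : (refl_mx x)^T = refl_mx ((x.1^-1)%g, x.2).
Proof.
apply/matrixP => i j; rewrite !mxE /=.
by rewrite -(inj_eq (@perm_inj _ x.1) (_ j)) permKV eq_sym.
Qed.

Lemma refl_mx1 : refl_mx refl_one = 1%:M.
Proof. by apply/matrixP => i j; rewrite !mxE perm1 subr0 eq_sym. Qed.

Lemma refl_mx_orth x : refl_mx x *m (refl_mx x)^T = 1%:M.
Proof.
by rewrite refl_mx_tr -refl_mxM /refl_mul /= mulVg addbb refl_mx1.
Qed.

Lemma refl_mx_inj : injective refl_mx.
Proof.
have c_neq0 : refl_coef true != 0 :> C.
  by rewrite mulf_neq0 ?invr_eq0 ?n_neq0 ?pnatr_eq0.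
move=> [s a] [t b] /matrixP eq_st.
have ab : a = b.
  (* As [n > 2], column [i0] has a row avoiding the ones of both permutations; the entries there are
     minus the coefficients and determine the booleans. *)
  have /subsetPn[i _ ist] : ~~ ([set: 'I_n] \subset [set s i0; t i0]).
    apply/negP => /subset_leq_card; rewrite cardsT card_ord cards2.
    by move/(leq_trans n_gt2); case: (_ != _).
  have := eq_st i i0; rewrite !mxE !inE /= in ist *.
  move: ist; rewrite negb_or ![i == _]eq_sym => /andP[/negPf-> /negPf->].
  rewrite !sub0r => /oppr_inj.
  by case: (a) (b) => -[] // /eqP; rewrite ?[0 == _]eq_sym (negPf c_neq0).
subst b; congr pair; apply/permP => j.
have := eq_st (s j) j; rewrite !mxE /= eqxx => /addIr /eqP.
by case: (eqVneq (t j) (s j)) => // _; rewrite oner_eq0.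
Qed.

Definition centering_mx : 'M[C]_n := \matrix_(i, j) ((i == j)%:R - n%:R^-1).

(** As [J Q = 0], the reflection fixes every [Q e_j], and [P_s] sends [Q e_j] to [Q e_(s j)]. *)
Lemma refl_mx_centering x i j :
  \sum_k refl_mx x i k * centering_mx k j = centering_mx i (x.1 j).
Proof.
have -> : \sum_k refl_mx x i k * centering_mx k j
  = \sum_k ((x.1 k == i)%:R * (k == j)%:R : C)
    - \sum_k (x.1 k == i)%:R * n%:R^-1
    - refl_coef x.2 * \sum_k (k == j)%:R
    + \sum_(k < n) refl_coef x.2 * n%:R^-1.
  rewrite mulr_sumr -!sumrB -big_split /=.
  by apply: eq_bigr => k _; rewrite !mxE; ring.
rewrite -!mulr_suml sum_perm_eq sumr_const card_ord mul1r.
rewrite (bigD1 j) //= eqxx mulr1 big1 => [|k /negPf->]; last by rewrite mulr0.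
rewrite (bigD1 j) //= eqxx big1 => [|k /negPf->] //.
by rewrite !mxE eq_sym -[true%:R]/1 -[refl_coef _ *+ n]mulr_natr; field.
Qed.

(* the vector [sum_i (Q e_i)^{(x)3}], with [Q = centering_mx] *)
Definition cubic (j : 3.-tuple 'I_n) : C :=
  \sum_i \prod_(m < 3) centering_mx (tnth j m) i.

(** The group permutes the vectors [Q e_i], hence the summands of [cubic]. *)
Lemma cubic_fixed x j :
  \sum_s cubic s * \prod_(m < 3) refl_mx x (tnth j m) (tnth s m) = cubic j.
Proof.
under eq_bigr do rewrite mulr_suml; rewrite exchange_big /=.
rewrite /cubic [RHS](reindex_inj (@perm_inj _ x.1)); apply: eq_bigr => i _.
under eq_bigr do rewrite -big_split /=.
rewrite (sum_tuple_prod
  (fun m k => centering_mx k i * refl_mx x (tnth j m) k)).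
apply: eq_bigr => m _; rewrite -refl_mx_centering.
by apply: eq_bigr => k _; rewrite mulrC.
Qed.

(** The diagonal coordinate is [(1 - 1/n)^3 - (n - 1)/n^3], which vanishes for [n = 1] and [n = 2]
    only. *)
Lemma cubic_neq0 a : cubic [tuple a | _ < 3] != 0.
Proof.
have -> : cubic [tuple a | _ < 3]
    = (n%:R - 1%:R) * (n%:R - 2%:R) / n%:R ^+ 2.
  rewrite /cubic; under eq_bigr do under eq_bigr do rewrite tnth_mktuple.
  under eq_bigr do rewrite prodr_const card_ord.
  rewrite (bigD1 a) //= mxE eqxx.
  rewrite (eq_bigr (fun=> (- n%:R^-1) ^+ 3)) => [|i]; last first.
    by rewrite eq_sym mxE => /negPf->; rewrite sub0r.
  rewrite sumr_const cardC1 card_ord -[_ ^+ 3 *+ _]mulr_natl -[true%:R]/1.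
  rewrite -subn1 natrB; first by field.
  exact: ltn_trans n_gt2.
rewrite -!natrB ?(ltnW n_gt2) //; last exact: ltn_trans n_gt2.
by rewrite !mulf_neq0 ?invr_eq0 ?expf_neq0 // pnatr_eq0 subn_eq0 -ltnNge //
  (ltn_trans _ n_gt2).
Qed.

Lemma sum_reflection_fixed (w : 3.-tuple 'I_n -> C) :
  (forall j, w j = \sum_s w s
     * \prod_(m < 3) refl_mx (1%g, true) (tnth j m) (tnth s m)) ->
  \sum_j w j = 0.
Proof.
move=> wfix; have : \sum_j w j = - \sum_j w j.
  rewrite {1}(eq_bigr _ (fun j _ => wfix j)) exchange_big -sumrN /=.
  apply: eq_bigr => s _; rewrite -mulr_sumr.
  rewrite (sum_tuple_prod (fun m i => refl_mx (1%g, true) i (tnth s m))).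
  (* Each column of the reflection sums to [1 - n (2/n) = -1], and the degree 3 is odd. *)
  rewrite (eq_bigr (fun=> -1)) => [|m _].
    by rewrite prodr_const card_ord; ring.
  by rewrite sum_refl_mx_col /=; field.
move/eqP; rewrite -subr_eq0 opprK -mulr2n -mulr_natl mulf_eq0 pnatr_eq0 /=.
exact: eqP.
Qed.

Definition refl_coord : 'M[Cfin R refl_one]_n := coord_mx _ refl_mx.

(** The coordinates of [T_p] are 0 or 1, so their sum vanishes only if all do; but a constant
    labelling is compatible with any [p]. *)
Lemma Tpart_not_intertwiner (p : blocks 0 3) :
  ~ intertwiner refl_coord (Tpart n p).
Proof.
move/intertwiner_vectorP => /(_ (1%g, true)) /sum_reflection_fixed/eqP.
have TE j : Tpart n p (tbasis [tuple]) j = (delta_part p [tuple] j)%:R :> C.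
  rewrite lfunE ffunE (bigD1 [tuple]) //= big1 ?addr0 => [|i].
    by rewrite tbasis_diag mul1r.
  by case/eqP; exact: tuple0.
rewrite (eq_bigr _ (fun j _ => TE j)) -natr_sum pnatr_eq0 sum_nat_eq0.
move/forallP/(_ [tuple i0 | _ < 3]); rewrite eqb0 => /negP; apply.
apply/forallP => B; apply/implyP => _.
apply/forallP => -[[]//|x]; apply/implyP => _.
apply/forallP => -[[]//|y]; apply/implyP => _.
by rewrite /= !tnth_mktuple.
Qed.

Lemma refl_coord_not_easy : ~ easy refl_coord.
Proof.
case=> _ [P [_ Peasy]].
pose w : tspace (R := R) n 3 := [ffun j => cubic j].
have wfix : intertwiner refl_coord (linfun (vector_fun w)).
  apply/intertwiner_vectorP => x j; rewrite vector_hom_tbasis ffunE.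
  by rewrite -[LHS](cubic_fixed x); apply: eq_bigr => s _; rewrite ffunE.
(* Any [p] here would make [T_p] an intertwiner, so the span containing [w] is zero. *)
have P0 : enum (P 0%N 3%N) = [::].
  case E: (enum _) => [//|p s].
  have pP : p \in P 0%N 3%N by rewrite -mem_enum E inE eqxx.
  case: (@Tpart_not_intertwiner p); apply/Peasy/memv_span.
  exact: image_f.
have := (Peasy _ _ _).1 wfix.
rewrite /image_mem P0 span_nil memv0 => /eqP w0.
have /eqP[] := cubic_neq0 i0.
have := congr1 (fun v : tspace n 3 => v [tuple i0 | _ < 3])
  (vector_hom_tbasis w).
by rewrite w0 zero_lfunE !ffunE => <-.
Qed.

End SymmetricWithReflection.

Local Close Scope complex_scope.
Local Close Scope ring_scope.

Theorem theorem4 (R : realType) (n : nat) (hn : 3 <= n) :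
  exists (A : cstarAlgType R) (u : 'M[A]_n),
    [/\ cmqg u,
        maximal u,
        forall (B : cstarAlgType R) (v : 'M[B]_n), free_orthogonal v ->
          exists f : B -> A, star_morphism f /\ forall i j, f (v i j) = u i j,
        exists g : A -> CSym R n,
          star_morphism g /\ forall i j, g (u i j) = sym_coord R n i j
      & ~ easy u].
Proof.
have real := @refl_mx_conj R n; have orth := refl_mx_orth R hn.
have inj := @refl_mx_inj R n hn.
exists (Cfin R (refl_one n)), (refl_coord R n); split.
- exact: (coord_mx_cmqg _ real orth inj (refl_mxM R hn)).
- exact: coord_mx_maximal inj.
- move=> B v [_ _ _]; apply; first exact: coord_mx_self_adjoint.
  exact: coord_mx_unitary.
(* Restriction of functions to the subgroup of permutation matrices. *)
- exists (fun f : Cfin R (refl_one n) => [ffun s => f (s, false)] : CSym R n).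
  split.
    by split=> [|a f g _ _|f g _ _|f _]; apply/ffunP => s; rewrite !ffunE.
  by move=> i j; apply/ffunP => s; rewrite !mxE !ffunE mxE subr0.
- exact: refl_coord_not_easy.
Qed.
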